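(* Let $T$ be a t-norm, $S$ a t-conorm, $N$ a fuzzy negation, and suppose that $I(x,y)=S(N(x),T(x,y))$, $x,y\in[0,1]$, is a QL-implication. Then in each of the following cases $I$ satisfies $I(I(y,x),I(x,y))=I(x,y)$ for all $x,y\in[0,1]$: (i) $S$ is a positive t-conorm (this implies that $N=N_{D_2}$); (ii) $T=T_M$ is the minimum t-norm, $T_M(x,y)=\min(x,y)$; (iii) $S=S_D$ is the drastic t-conorm, $N$ is any non-vanishing negation, and $T$ is a positive t-norm.
   Context: A function $I\colon[0,1]^2\to[0,1]$ is a fuzzy implication if $I(\cdot,y)$ is non-increasing for each $y$, $I(x,\cdot)$ is non-decreasing for each $x$, and $I(0,0)=1$, $I(1,1)=1$, $I(1,0)=0$. A t-norm (resp. t-conorm) is a commutative, associative function $[0,1]^2\to[0,1]$, non-decreasing in each variable, with neutral element $1$ (resp. $0$). A fuzzy negation is a non-increasing $N\colon[0,1]\to[0,1]$ with $N(0)=1$, $N(1)=0$. A function of the form $I(x,y)=S(N(x),T(x,y))$ is called a QL-operation; it is called a QL-implication if it is moreover a fuzzy implication. A t-conorm $S$ is positive if $S(x,y)=1$ implies $x=1$ or $y=1$. A t-norm $T$ is positive if $T(x,y)=0$ implies $x=0$ or $y=0$. A fuzzy negation $N$ is non-vanishing if $N(x)=0\iff x=1$. $N_{D_2}$ is the negation with $N_{D_2}(1)=0$ and $N_{D_2}(x)=1$ for $x<1$. The drastic t-conorm is $S_D(x,y)=y$ if $x=0$, $S_D(x,y)=x$ if $y=0$, and $S_D(x,y)=1$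 otherwise. *)

(* Defs.v *)
From HB Require Import structures.
From mathcomp Require Import all_boot all_order all_algebra.
From mathcomp Require Import interval_inference reals.
Set Implicit Arguments.
Unset Strict Implicit.
Unset Printing Implicit Defensive.
Import Order.TTheory GRing.Theory Num.Theory.
Local Open Scope ring_scope.

(* The real unit interval [0,1] is the type {i01 R}, whose order is the one
   inherited from R. *)
Definition i0 {R : realType} : {i01 R} := 0%:i01.
Definition i1 {R : realType} : {i01 R} := 1%:i01.

Section FuzzyConnectives.
Variable R : realType.
Local Notation U := {i01 R}.
Implicit Types (I S T : U -> U -> U) (N : U -> U).

Record fuzzy_implication I : Prop := FuzzyImplication {
  fimpl_noninc : forall y, {homo I^~ y : x1 x2 / x1 <= x2 >-> x2 <= x1};
  fimpl_nondec : forall x, {homo I x : y1 y2 / y1 <= y2};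
  fimpl00 : I i0 i0 = i1;
  fimpl11 : I i1 i1 = i1;
  fimpl10 : I i1 i0 = i0 }.

Record t_norm T : Prop := TNorm {
  tnormC : commutative T;
  tnormA : associative T;
  tnorm_homol : forall y, {homo T^~ y : x1 x2 / x1 <= x2};
  tnorm_homor : forall x, {homo T x : y1 y2 / y1 <= y2};
  tnorm1x : left_id i1 T;
  tnormx1 : right_id i1 T }.

Record t_conorm S : Prop := TConorm {
  tconormC : commutative S;
  tconormA : associative S;
  tconorm_homol : forall y, {homo S^~ y : x1 x2 / x1 <= x2};
  tconorm_homor : forall x, {homo S x : y1 y2 / y1 <= y2};
  tconorm0x : left_id i0 S;
  tconormx0 : right_id i0 S }.

Record fuzzy_negation N : Prop := FuzzyNegation {
  fneg_noninc : {homo N : x1 x2 / x1 <= x2 >-> x2 <= x1};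
  fneg0 : N i0 = i1;
  fneg1 : N i1 = i0 }.

Definition QL_operation S N T : U -> U -> U := fun x y => S (N x) (T x y).

Definition QL_implication I S N T : Prop :=
  (forall x y, I x y = QL_operation S N T x y) /\ fuzzy_implication I.

Definition positive_t_conorm S : Prop :=
  forall x y, S x y = i1 -> x = i1 \/ y = i1.

Definition positive_t_norm T : Prop :=
  forall x y, T x y = i0 -> x = i0 \/ y = i0.

Definition non_vanishing N : Prop := forall x, N x = i0 <-> x = i1.

Definition N_D2 : U -> U := fun x => if x == i1 then i0 else i1.

Definition T_M : U -> U -> U := fun x y => Order.min x y.

Definition S_D : U -> U -> U := fun x y =>
  if x == i0 then y else if y == i0 then x else i1.

End FuzzyConnectives.

(* Main.v *)
(* The implication satisfies I(x,1) = 1 and I(1,y) = y, so the identity holds at (x,y)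
   as soon as I(x,y) = 1 or I(y,x) = 1; each of the three cases ensures this
   disjunction for all x and y. *)
Require Import Defs.
From HB Require Import structures.
From mathcomp Require Import all_boot all_order all_algebra.
From mathcomp Require Import interval_inference reals.
Import Order.TTheory GRing.Theory Num.Theory.
Local Open Scope ring_scope.

(** Since [I] is antitone in its first argument and [I i1 i1 = i1], [I x i1 = i1] for all [x]; as
    [T x i1 = x], this is the law of excluded middle [S (N x) x = i1] ([QL_excluded_middle]). It
    settles the positive and the minimum case; the drastic case comes down to a check away from the
    boundary. [QL_prelinear] then turns each disjunction into the identity. *)

Lemma i01_le1 (R : realType) (x : {i01 R}) : x <= i1.
Proof. by rewrite -num_le /=. Qed.

Lemma i01_ge0 (R : realType) (x : {i01 R}) : i0 <= x.
Proof. by rewrite -num_le /=. Qed.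

Lemma tconorm1x (R : realType) (S : {i01 R} -> {i01 R} -> {i01 R}) (x : {i01 R}) :
  t_conorm S -> S i1 x = i1.
Proof.
move=> hS; apply/eqP; rewrite eq_le i01_le1 /=.
by rewrite -[leLHS](tconormx0 hS); apply: (tconorm_homor hS); exact: i01_ge0.
Qed.

Set Implicit Arguments.
Unset Strict Implicit.

Section QLImplication.
Variables (R : realType) (T S I : {i01 R} -> {i01 R} -> {i01 R}).
Variable N : {i01 R} -> {i01 R}.
Hypotheses (hT : t_norm T) (hS : t_conorm S) (hN : fuzzy_negation N).
Hypothesis hI : QL_implication I S N T.

Lemma QL_implx1 x : I x i1 = i1.
Proof.
case: hI => _ fI; apply/eqP; rewrite eq_le i01_le1 /= -[leLHS](fimpl11 fI).
by apply: (fimpl_noninc fI); exact: i01_le1.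
Qed.

Lemma QL_impl1x y : I i1 y = y.
Proof. by rewrite hI.1 /QL_operation (fneg1 hN) (tconorm0x hS) (tnorm1x hT). Qed.

Lemma QL_impl0x y : I i0 y = i1.
Proof. by rewrite hI.1 /QL_operation (fneg0 hN) tconorm1x. Qed.

Lemma QL_excluded_middle x : S (N x) x = i1.
Proof. by rewrite -(QL_implx1 x) hI.1 /QL_operation (tnormx1 hT). Qed.

Lemma QL_prelinear x y :
  I x y = i1 \/ I y x = i1 -> I (I y x) (I x y) = I x y.
Proof. by case=> ->; rewrite ?QL_implx1 ?QL_impl1x. Qed.

(** Positivity splits excluded middle: [N x = i1] or [x = i1]. *)
Lemma QL_positive_neg x : positive_t_conorm S -> N x = N_D2 x.
Proof.
move=> pS; rewrite /N_D2; case: eqP => [->|x1]; first exact: fneg1.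
by case: (pS _ _ (QL_excluded_middle x)).
Qed.

(** For [x] other than [i1], [N x = i1] is absorbing for [S], so [I x y = i1] whatever [y] is. *)
Lemma QL_positive_disj x y :
  positive_t_conorm S -> I x y = i1 \/ I y x = i1.
Proof.
move=> pS; have [->|/negPf x1] := eqVneq x i1; first by right; exact: QL_implx1.
by left; rewrite hI.1 /QL_operation QL_positive_neg // /N_D2 x1 tconorm1x.
Qed.

(** If [u <= v], the minimum is [u], so [I u v] is the excluded middle [S (N u) u]; the order is
    total. *)
Lemma QL_min_disj x y :
  (forall u v, T u v = T_M u v) -> I x y = i1 \/ I y x = i1.
Proof.
move=> TM; have I1 u v : u <= v -> I u v = i1.
  by move=> uv; rewrite hI.1 /QL_operation TM /T_M min_l // QL_excluded_middle.
by case/orP: (le_total x y) => /I1; [left | right].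
Qed.

Lemma QL_drastic_disj x y :
  (forall u v, S u v = S_D u v) -> non_vanishing N -> positive_t_norm T ->
  I x y = i1 \/ I y x = i1.
Proof.
move=> SD nN pT; have [->|/eqP x1] := eqVneq x i1; first by right; exact: QL_implx1.
have [->|/eqP x0] := eqVneq x i0; first by left; exact: QL_impl0x.
have [->|/eqP y0] := eqVneq y i0; first by right; exact: QL_impl0x.
(* With [x] different from [i0] and [i1], and [y] from [i0], both [N x] and [T x y] are nonzero, and
   [S_D] of two nonzero values is [i1]. *)
left; rewrite hI.1 /QL_operation SD /S_D.
by case: eqP => [/nN //|_]; case: eqP => [/pT[]|].
Qed.

End QLImplication.

Theorem theorem2p8 (R : realType) (T S : {i01 R} -> {i01 R} -> {i01 R})
    (N : {i01 R} -> {i01 R}) (I : {i01 R} -> {i01 R} -> {i01 R})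
    (hT : t_norm T) (hS : t_conorm S) (hN : fuzzy_negation N)
    (hI : QL_implication I S N T) :
  (positive_t_conorm S ->
     (forall x : {i01 R}, N x = N_D2 x) /\
     (forall x y : {i01 R}, I (I y x) (I x y) = I x y)) /\
  ((forall x y : {i01 R}, T x y = T_M x y) ->
     forall x y : {i01 R}, I (I y x) (I x y) = I x y) /\
  ((forall x y : {i01 R}, S x y = S_D x y) ->
     non_vanishing N -> positive_t_norm T ->
     forall x y : {i01 R}, I (I y x) (I x y) = I x y).
Proof.
have pre := QL_prelinear hT hS hN hI.
split; [move=> pS; split=> [x|x y]|split=> [TM x y|SD nN pT x y]].
- exact: (QL_positive_neg hT hN hI).
- by apply: pre; apply: (QL_positive_disj hT hS hN hI).
- by apply: pre; apply: (QL_min_disj hT hI).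
- by apply: pre; apply: (QL_drastic_disj hS hN hI).
Qed.
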